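(* Let $a\geq 1$, $b\geq 1$, $g\geq 3$ be integers. Then $n(a,b,g)\geq M_1^{+}(a,b,g)$ when $g$ is odd; $n(a,b,g)\geq M_2^{+}(a,b,g)$ when $g$ is even; and $n(1,2,10)\geq M_3^{+}(1,2,10)=16$.
   Context: A weighted graph (wgraph) is a pair $G=(L,H)$ of simple finite graphs with $V(L)=V(H)$ and $E(L)\cap E(H)=\varnothing$; edges of $L$ are light (weight 1) and edges of $H$ are heavy (weight 2). A wcycle is a cycle (of length at least 3) in the graph with edge set $E(L)\cup E(H)$; its weight is the sum of the weights of its edges. The girth of $G$ is the minimum weight of a wcycle. $G$ is $(a,b)$-regular if $L$ is $a$-regular and $H$ is $b$-regular. An $(a,b,g)$-wgraph is an $(a,b)$-regular wgraph of girth $g$. $n(a,b,g)$ denotes the minimum order of an $(a,b,g)$-wgraph ($\infty$ if none exists). Given base values $L_0,H_0,L_1,H_1$, define for $i\geq 2$: $L_i=(a-1)L_{i-1}+aH_{i-1}$ and $H_i=(b-1)H_{i-2}+bL_{i-2}$. For odd $g$, $M_1(a,b,g)=\sum_{i=0}^{(g-1)/2}(L_i+H_i)$ with base values $L_0=1,H_0=0,L_1=a,H_1=0$. For even $g$, $M_2(a,b,g)=\sum_{i=0}^{(g-2)/2}(L_i+H_i)$ with base values $L_0=2,H_0=0,L_1=2(a-1),H_1=0$, and $M_3(a,b,g)=\sum_{i=0}^{(g-2)/2}(L_i+H_i)$ with base values $L_0=0,H_0=1,L_1=a,H_1=1$. For $j\in\{1,2,3\}$, $M_j^{+}=M_j+1$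 if $M_j$ is odd and at least one of $a,b$ is odd, and $M_j^{+}=M_j$ otherwise. *)

(* Defs.v *)
From mathcomp Require Import all_boot.
From mathcomp Require Import boolp.

Set Implicit Arguments.
Unset Strict Implicit.
Unset Printing Implicit Defensive.

(* Extended naturals: None stands for infinity. *)
Definition enat := option nat.

Definition le_enat (m n : enat) : bool :=
  match m, n with
  | _, None => true
  | None, Some _ => false
  | Some m', Some n' => m' <= n'
  end.

Definition min_enat (P : nat -> Prop) : enat :=
  match pselect (exists n, `[< P n >]) with
  | left exP => Some (ex_minn exP)
  | right _ => None
  end.

Lemma min_enat_Some (P : nat -> Prop) (m : nat) :
  min_enat P = Some m <-> P m /\ (forall k, P k -> m <= k).
Proof.
rewrite /min_enat; case: pselect => [exP|nexP].
  case: ex_minnP => n /asboolP Pn minn; split=> [[<-]|[Pm minm]].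
    by split=> // k Pk; apply/minn/asboolP.
  by congr Some; apply/eqP; rewrite eqn_leq minm // andbT minn //; apply/asboolP.
by split=> // -[Pm _]; case: nexP; exists m; apply/asboolP.
Qed.

Lemma min_enat_None (P : nat -> Prop) :
  min_enat P = None <-> forall k, ~ P k.
Proof.
rewrite /min_enat; case: pselect => [exP|nexP].
  by split=> // nP; exfalso; case: exP => k /asboolP /nP.
by split=> // _ k Pk; case: nexP; exists k; apply/asboolP.
Qed.

Record wgraph (T : finType) := WGraph {
  light : rel T;
  heavy : rel T;
  light_sym : symmetric light;
  light_irr : irreflexive light;
  heavy_sym : symmetric heavy;
  heavy_irr : irreflexive heavy;
  light_heavy_disj : forall x y, ~~ (light x y && heavy x y) }.

Definition edge (T : finType) (G : wgraph T) : rel T :=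
  fun x y => light G x y || heavy G x y.

(* Only meaningful when x and y are adjacent. *)
Definition edge_weight (T : finType) (G : wgraph T) (x y : T) : nat :=
  if light G x y then 1 else 2.

(* A cycle is given by the sequence of its pairwise distinct vertices, the
   last one being adjacent to the first. *)
Definition wcycle (T : finType) (G : wgraph T) (c : seq T) : Prop :=
  3 <= size c /\ ucycle (edge G) c.

Definition weight (T : finType) (G : wgraph T) (c : seq T) : nat :=
  \sum_(x <- c) edge_weight G x (next c x).

Definition girth (T : finType) (G : wgraph T) : enat :=
  min_enat (fun w => exists2 c, wcycle G c & weight G c = w).

Definition regular (T : finType) (e : rel T) (d : nat) : Prop :=
  forall x, #|[set y | e x y]| = d.

Definition is_wgraph (a b g : nat) (T : finType) (G : wgraph T) : Prop :=
  [/\ regular (light G) a, regular (heavy G) b & girth G = Some g].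

Definition min_order (a b g : nat) : enat :=
  min_enat (fun k => exists (T : finType) (G : wgraph T),
    is_wgraph a b g G /\ #|T| = k).

(* The subtractions are truncated: a and b are meant to be positive. *)
Fixpoint Lrec (a b L0 H0 L1 H1 i : nat) {struct i} : nat :=
  match i with
  | 0 => L0
  | 1 => L1
  | (_.+1 as j).+1 =>
      (a - 1) * Lrec a b L0 H0 L1 H1 j + a * Hrec a b L0 H0 L1 H1 j
  end
with Hrec (a b L0 H0 L1 H1 i : nat) {struct i} : nat :=
  match i with
  | 0 => H0
  | 1 => H1
  | j.+2 =>
      (b - 1) * Hrec a b L0 H0 L1 H1 j + b * Lrec a b L0 H0 L1 H1 j
  end.

Definition LHsum (a b L0 H0 L1 H1 r : nat) : nat :=
  \sum_(0 <= i < r.+1) (Lrec a b L0 H0 L1 H1 i + Hrec a b L0 H0 L1 H1 i).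

(* M1 is meant for odd g, M2 and M3 for even g. *)
Definition M1 (a b g : nat) : nat := LHsum a b 1 0 a 0 ((g - 1) %/ 2).
Definition M2 (a b g : nat) : nat := LHsum a b 2 0 (2 * (a - 1)) 0 ((g - 2) %/ 2).
Definition M3 (a b g : nat) : nat := LHsum a b 0 1 a 1 ((g - 2) %/ 2).

Definition Mplus (M : nat -> nat -> nat -> nat) (a b g : nat) : nat :=
  if odd (M a b g) && (odd a || odd b) then M a b g + 1 else M a b g.

(* Main.v *)
Require Import Defs.
From mathcomp Require Import all_boot zify.

(* Moore's argument.  The non-backtracking walks from a root vertex are counted,
   by weight and by the kind of their last edge, by the recurrences for L_i and
   H_i.  Two different ones with the same endpoint join into a closed walk that
   backtracks at most at the root, so it contains a wcycle, of weight at most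
   the sum of their weights; below the girth, endpoints are therefore distinct.
   For even g the root is an edge uv: walks start with uv or vu, and this edge
   is counted at most once in a closed walk obtained by joining two of them.
   The correction from M to M^+ is the handshake lemma. *)

Set Implicit Arguments.
Unset Strict Implicit.
Unset Printing Implicit Defensive.

(** * Parity of the degree sum *)

Lemma handshake (T : finType) (e : rel T) (d : nat) :
  symmetric e -> irreflexive e -> regular e d -> ~~ odd (d * #|T|).
Proof.
move=> esym eirr ereg.
(* Ordered adjacent pairs are split by which vertex is enumerated first; symmetry exchanges the two
   halves. *)
pose S (P : rel nat) :=
  \sum_(x : T) \sum_(y | P (enum_rank x) (enum_rank y)) (e x y : nat).
have -> : d * #|T| = \sum_(x : T) \sum_(y : T) (e x y : nat).
  rewrite mulnC -sum_nat_const; apply: eq_bigr => x _.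
  rewrite -(ereg x) -sum1_card big_mkcond; apply: eq_bigr => y _.
  by rewrite inE; case: (e x y).
have -> : \sum_(x : T) \sum_(y : T) (e x y : nat) = S ltn + S gtn.
  rewrite -big_split; apply: eq_bigr => x _ /=.
  rewrite (bigID (fun y => enum_rank x < enum_rank y)) /=; congr (_ + _).
  rewrite big_mkcond [RHS]big_mkcond /=; apply: eq_bigr => y _.
  by case: ltngtP => // /val_inj/enum_rank_inj ->; rewrite eirr.
have -> : S gtn = S ltn.
  rewrite /S (exchange_big_dep xpredT) //=; apply: eq_bigr => x _.
  by apply: eq_bigr => y _; rewrite esym.
by rewrite addnn odd_double.
Qed.

(** * Non-backtracking walks and the cycles they contain *)

Section Walks.
Variables (T : finType) (G : wgraph T).

(* Walks are listed from their endpoint back to their root. *)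
Fixpoint nbwalk (s : seq T) : bool :=
  if s is x :: s' then
    nbwalk s' &&
    (if s' is y :: s'' then edge G x y && (ohead s'' != Some x) else true)
  else true.

Fixpoint walk_weight (s : seq T) : nat :=
  if s is x :: s' then
    (if s' is y :: _ then edge_weight G x y else 0) + walk_weight s'
  else 0.

Lemma edge_sym : symmetric (edge G).
Proof. by move=> x y; rewrite /edge light_sym heavy_sym. Qed.

Lemma edge_irr : irreflexive (edge G).
Proof. by move=> x; rewrite /edge light_irr heavy_irr. Qed.

Lemma edge_weight_sym x y : edge_weight G x y = edge_weight G y x.
Proof. by rewrite /edge_weight light_sym. Qed.

Lemma nbwalk_catl s t : nbwalk (s ++ t) -> nbwalk s.
Proof.
elim: s => [|x s IH] //= /andP[/IH -> /=].
by case: s {IH} => [|y [|z s]] //= /andP[-> _].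
Qed.

Lemma nbwalk_path x p : nbwalk (x :: p) -> path (edge G) x p.
Proof.
elim: p x => [|y p IH] x // /andP[w /andP[exy _]] /=.
by rewrite exy IH.
Qed.

Lemma walk_weight_rcons s y z :
  walk_weight (rcons (rcons s y) z) =
  walk_weight (rcons s y) + edge_weight G y z.
Proof.
elim: s => [|x s IH] /=; first lia.
rewrite IH addnA; congr (_ + _ + _).
by case: s {IH}.
Qed.

Lemma walk_weight_catl s t : walk_weight s <= walk_weight (s ++ t).
Proof.
elim: s => [|x s IH] //=; apply: leq_add => //.
by case: s {IH}.
Qed.

(** Two walks are joined at their common endpoint [x], the first one reversed; the last premise
    forbids turning back at [x]. *)
Lemma nbwalk_catrev x p q :
  nbwalk (x :: p) -> nbwalk (x :: q) ->
  (if p is y :: _ then ohead q != Some y else true) ->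
  nbwalk (catrev p (x :: q)).
Proof.
elim: p x q => [|y p IH] x q // /andP[wp /andP[exy pNx]] wq qNy.
apply: IH => //.
  by move: wq => /= ->; rewrite edge_sym exy.
by case: p pNx {wp} => //= z _; rewrite eq_sym.
Qed.

Lemma walk_weight_catrev x p q :
  walk_weight (catrev p (x :: q)) = walk_weight (x :: p) + walk_weight (x :: q).
Proof.
elim: p x q => [|y p IH] x q //.
rewrite [LHS]IH /= (edge_weight_sym y x); lia.
Qed.

Lemma weight_walk x p :
  uniq (x :: p) -> weight G (x :: p) = walk_weight (x :: rcons p x).
Proof.
(* The vertex [x0] closing the cycle is decoupled from the head, so that the induction can advance
   the head. *)
suff H x0 : uniq (x :: p) ->
    \sum_(y <- x :: p) edge_weight G y (next_at y x0 x p) =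
    walk_weight (x :: rcons p x0) by exact: H.
elim: p x => [|y p IH] x.
  by rewrite big_seq1 /= eqxx !addn0.
rewrite cons_uniq => /andP[xNp up]; rewrite big_cons /= eqxx.
rewrite -[in RHS]/(walk_weight (y :: rcons p x0)) -IH //.
congr (_ + _); apply: eq_big_seq => z zp; case: eqP => // zx.
by rewrite -zx zp in xNp.
Qed.

(* A shortest closed subwalk is a cycle: it has length at least 3 because the
   walk neither stays nor turns back. *)
Lemma nbwalk_wcycle s :
  nbwalk s -> ~~ uniq s -> exists2 c, wcycle G c & weight G c <= walk_weight s.
Proof.
elim: s => [|x p IH] //= /andP[wp hx].
have [up|nup _] := boolP (uniq p); last first.
  have [c cc cw] := IH wp nup; exists c => //; lia.
rewrite andbT negbK => xp.
have wxp : nbwalk (x :: p) by rewrite /= wp.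
rewrite -[_ + _]/(walk_weight (x :: p)).
(* The tail has no repetition, so cutting it at its only [x] leaves the cycle [x :: p1]. *)
move: up wxp {hx wp IH}; case/path.splitP: xp => p1 p2 up wxp.
rewrite cat_uniq rcons_uniq in up; case/and3P: up => /andP[xNp1 up1] _ _.
have w1 : nbwalk (x :: rcons p1 x) by apply: (@nbwalk_catl _ p2).
exists (x :: p1); last first.
  rewrite weight_walk; last by rewrite /= xNp1.
  exact: (walk_weight_catl (x :: rcons p1 x) p2).
split; last by rewrite /ucycle /= xNp1 up1 (nbwalk_path w1).
case: p1 {up1 xNp1 wxp} w1 => [|y [|z p1]] //=.
  by rewrite edge_irr.
by rewrite eqxx !andbF.
Qed.

(** Shared vertices are stripped from the endpoint side. Where the walks separate, they join into a
    closed walk lighter than the girth; if one is exhausted first, the other is itself closed. *)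
Lemma nbwalk_eq g x p q :
  (forall c, wcycle G c -> g <= weight G c) ->
  nbwalk (x :: p) -> nbwalk (x :: q) -> last x p = last x q ->
  walk_weight (x :: p) + walk_weight (x :: q) < g -> p = q.
Proof.
move=> gmin.
have closed s : nbwalk s -> walk_weight s < g -> uniq s.
  move=> ws wg; apply/negPn/negP => /(nbwalk_wcycle ws)[c cc cw].
  by have := gmin _ cc; lia.
elim: p q x => [|y p IH] [|z q] x //.
- move=> _ wq /= xq wg.
  have /andP[+ _] : uniq (x :: z :: q).
    by apply: closed => //; apply: leq_ltn_trans wg; apply: leq_addl.
  by rewrite xq mem_last.
- move=> wp _ /= xp wg.
  have /andP[+ _] : uniq (x :: y :: p).
    by apply: closed => //; apply: leq_ltn_trans wg; apply: leq_addr.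
  by rewrite -xp mem_last.
move=> wp wq lpq wg; have [yz|yz] := eqVneq y z.
  subst z; congr (_ :: _); apply: (IH q y) => //.
  - by case/andP: wp.
  - by case/andP: wq.
  move: wg; rewrite ![walk_weight [:: x, _ & _]]/=.
  rewrite -!/(walk_weight (y :: _)); lia.
have := @nbwalk_catrev x (y :: p) (z :: q) wp wq.
rewrite /= -[Some z == _]/(z == y) eq_sym => /(_ yz) w.
have := closed _ w.
rewrite -[walk_weight _]/(walk_weight (catrev (y :: p) (x :: z :: q))).
rewrite walk_weight_catrev => /(_ wg).
rewrite -[catrev _ _]/(catrev (y :: p) (x :: z :: q)) catrevE.
rewrite cat_uniq => /and3P[_ /hasPn/(_ (last y p)) + _].
rewrite mem_rev mem_last.
suff -> : last y p \in [:: x, z & q] by move=> /(_ isT).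
by rewrite -[last y p]/(last x (y :: p)) lpq; apply: (mem_last x (z :: q)).
Qed.

(** * Extending walks by one edge of a given kind *)

Definition nexts (e : rel T) (s : seq T) : seq T :=
  if s is y :: s' then [seq z <- enum T | e y z && (ohead s' != Some z)]
  else [::].

Definition extend (e : rel T) (S : seq (seq T)) : seq (seq T) :=
  [seq z :: s | s <- S, z <- nexts e s].

Definition arrives (e : rel T) (s : seq T) : bool :=
  if s is x :: y :: _ then e x y else false.

Lemma mem_extend e S t :
  t \in extend e S ->
  exists s z, [/\ s \in S, t = z :: s & z \in nexts e s].
Proof. by case/allpairsPdep => s [z [sS zs ->]]; exists s, z. Qed.

Lemma uniq_extend e S : uniq S -> uniq (extend e S).
Proof.
move=> uS; apply: allpairs_uniq_dep => //.
  by case=> [|y s] // _; apply/filter_uniq/enum_uniq.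
by move=> [s z] [s' z'] _ _ /= [-> ->].
Qed.

Lemma extend_cat e S1 S2 : extend e (S1 ++ S2) = extend e S1 ++ extend e S2.
Proof. by rewrite /extend map_cat flatten_cat. Qed.

Lemma size_extend e S k :
  {in S, forall s, size (nexts e s) = k} -> size (extend e S) = k * size S.
Proof.
rewrite size_allpairs_dep; elim: S => [|s S IH] Sk /=; first by rewrite muln0.
rewrite mulnS Sk ?mem_head // IH // => t tS.
by apply: Sk; rewrite inE tS orbT.
Qed.

(** The excluded predecessor is one of the [d] neighbours exactly when the walk arrived along an
    [e]-edge. *)
Lemma size_nexts e d y s :
  regular e d -> size (nexts e (y :: s)) = d - arrives e (y :: s).
Proof.
move=> /(_ y) <- /=.
have -> : size [seq z <- enum T | e y z && (ohead s != Some z)] =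
    #|[set z | e y z && (ohead s != Some z)]|.
  rewrite cardE; congr size; rewrite /enum_mem -enumT.
  by rewrite -filter_predI; apply: eq_filter => z /=; rewrite !inE andbT.
case: s => [|z s] /=.
  by rewrite subn0; apply: eq_card => z; rewrite !inE andbT.
rewrite (cardsD1 z [set y0 | e y y0]) inE addKn.
by apply: eq_card => x; rewrite !inE andbC; congr andb; rewrite eq_sym.
Qed.

(** * Layers of rooted walks, counted by the recurrences *)

Section Layers.
Variables (a b : nat) (x0 : T) (c : T -> nat) (bases : seq (seq T)).
Hypotheses (regL : regular (light G) a) (regH : regular (heavy G) b).

(* The weight in excess of [c (root)] is the index i of L_i and H_i; c discounts
   the root edge, if any, which each of the bounds M_j does differently. *)
Definition rooted (i : nat) (s : seq T) : bool :=
  [&& nbwalk s, walk_weight s == i + c (last x0 s) &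
      has (fun B => suffix B s) bases].

Lemma rooted_cons i k s z :
  rooted i s ->
  z \in nexts (fun y w => edge G y w && (edge_weight G y w == k)) s ->
  rooted (i + k) (z :: s).
Proof.
case: s => [|y s] //= /and3P[ws /eqP wt /hasP[B Bb Bs]].
rewrite mem_filter => /andP[/andP[/andP[eyz /eqP wyz] sNz] _].
apply/and3P; split.
- by rewrite -[nbwalk _]/(nbwalk (y :: s) && _) ws edge_sym eyz.
- by apply/eqP; move: wt => /= ->; rewrite edge_weight_sym wyz; lia.
- by apply/hasP; exists B => //; apply: suffix_trans Bs (suffix_cons _ _).
Qed.

(* The one-vertex walk counts as light since L_0 = 1, H_0 = 0 in M_1. *)
Definition light_end s := (size s == 1) || arrives (light G) s.
Definition heavy_end s := arrives (heavy G) s.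

Lemma light_heavy_end s : light_end s -> heavy_end s -> False.
Proof.
case: s => [|x [|y s]] // lxy hxy.
by have := light_heavy_disj G x y; rewrite (lxy : light G x y) (hxy : heavy G x y).
Qed.

Definition layer (i : nat) (E : pred (seq T)) (S : seq (seq T)) (n : nat) :=
  [/\ uniq S, size S = n & {in S, forall s, rooted i s && E s}].

Lemma rooted_light i s z :
  rooted i s -> z \in nexts (light G) s ->
  rooted i.+1 (z :: s) && light_end (z :: s).
Proof.
move=> rs zs; apply/andP; split; last first.
  case: s zs {rs} => [|y s] //=; rewrite mem_filter => /andP[/andP[lyz _] _].
  by rewrite /light_end /= light_sym.
rewrite -addn1; apply: rooted_cons => //.
case: s zs {rs} => [|y s] //=; rewrite !mem_filter => /andP[/andP[lyz ->] ->].
by rewrite /edge /edge_weight lyz.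
Qed.

Lemma rooted_heavy i s z :
  rooted i s -> z \in nexts (heavy G) s ->
  rooted i.+2 (z :: s) && heavy_end (z :: s).
Proof.
move=> rs zs; apply/andP; split; last first.
  case: s zs {rs} => [|y s] //=; rewrite mem_filter => /andP[/andP[hyz _] _].
  by rewrite /heavy_end /= heavy_sym.
rewrite -addn2; apply: rooted_cons => //.
case: s zs {rs} => [|y s] //=; rewrite !mem_filter => /andP[/andP[hyz ->] ->].
have := light_heavy_disj G y z; rewrite hyz andbT => lyz.
by rewrite /edge /edge_weight hyz (negPf lyz).
Qed.

Lemma layer_uniq_cat i j S1 S2 n1 n2 :
  layer i light_end S1 n1 -> layer j heavy_end S2 n2 -> uniq (S1 ++ S2).
Proof.
move=> [u1 _ r1] [u2 _ r2]; rewrite cat_uniq u1 u2 andbT /=.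
apply/hasPn => s /r2/andP[_ hs]; apply/negP => /r1/andP[_ ls].
exact: light_heavy_end ls hs.
Qed.

Lemma layer_light i SL SH nL nH :
  layer i.+1 light_end SL nL -> layer i.+1 heavy_end SH nH ->
  layer i.+2 light_end (extend (light G) (SL ++ SH)) ((a - 1) * nL + a * nH).
Proof.
move=> lL lH; split.
- exact/uniq_extend/(layer_uniq_cat lL lH).
- case: lL lH => [_ <- rL] [_ <- rH].
  rewrite extend_cat size_cat; congr (_ + _); apply: size_extend => s.
    (* The positive index excludes the one-vertex walk, which would have [a] light continuations
       instead of [a - 1]. *)
    case/rL/andP; case: s => [|y [|z s]] //.
    by move=> _ lyz; rewrite (size_nexts _ _ regL) (lyz : arrives _ _).
  case/rH/andP; case: s => [|y s] // _ hs.
  rewrite (size_nexts _ _ regL); case: s hs => [|z s] hyz; first exact: subn0.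
  have := light_heavy_disj G y z.
  by rewrite (hyz : heavy G y z) andbT /= => /negPf ->; apply: subn0.
move=> t /mem_extend[s [z [sS -> zs]]]; apply: rooted_light => //.
case: lL lH => [_ _ rL] [_ _ rH].
by move: sS; rewrite mem_cat => /orP[/rL/andP[]|/rH/andP[]].
Qed.

(** A heavy edge weighs 2, so index [i] feeds [i.+2]. The one-vertex walk may occur here: like any
    light-ended walk it has [b] heavy continuations. *)
Lemma layer_heavy i SL SH nL nH :
  layer i light_end SL nL -> layer i heavy_end SH nH ->
  layer i.+2 heavy_end (extend (heavy G) (SH ++ SL)) ((b - 1) * nH + b * nL).
Proof.
move=> lL lH; split.
- by apply: uniq_extend; rewrite uniq_catC; apply: (layer_uniq_cat lL lH).
- case: lL lH => [_ <- rL] [_ <- rH].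
  rewrite extend_cat size_cat; congr (_ + _); apply: size_extend => s.
    case/rH/andP; case: s => [|y s] // _ hs.
    by rewrite (size_nexts _ _ regH) (hs : arrives _ _).
  case/rL/andP; case: s => [|y s] // _ ls.
  rewrite (size_nexts _ _ regH); case: s ls => [|z s] lyz; first exact: subn0.
  have := light_heavy_disj G y z.
  by rewrite (lyz : light G y z) /= => /negPf ->; apply: subn0.
move=> t /mem_extend[s [z [sS -> zs]]]; apply: rooted_heavy => //.
case: lL lH => [_ _ rL] [_ _ rH].
by move: sS; rewrite mem_cat => /orP[/rH/andP[]|/rL/andP[]].
Qed.

Variables (A0 B0 A1 B1 : seq (seq T)) (L0 H0 L1 H1 : nat).
Hypotheses (lA0 : layer 0 light_end A0 L0) (lB0 : layer 0 heavy_end B0 H0).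
Hypotheses (lA1 : layer 1 light_end A1 L1) (lB1 : layer 1 heavy_end B1 H1).

Lemma layers i :
  exists SL SH, layer i light_end SL (Lrec a b L0 H0 L1 H1 i) /\
                layer i heavy_end SH (Hrec a b L0 H0 L1 H1 i).
Proof.
(* Two consecutive indices are carried along because the heavy recurrence reaches back two steps. *)
pose P i := exists SL SH, layer i light_end SL (Lrec a b L0 H0 L1 H1 i) /\
                layer i heavy_end SH (Hrec a b L0 H0 L1 H1 i).
suff [] : P i /\ P i.+1 by [].
elim: i => [|i [[SL [SH [lL lH]]] [SL' [SH' [lL' lH']]]]].
  by split; [exists A0, B0 | exists A1, B1].
split; first by exists SL', SH'.
exists (extend (light G) (SL' ++ SH')), (extend (heavy G) (SH ++ SL)).
by split; [apply: layer_light | apply: layer_heavy].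
Qed.

Lemma rooted_ball r :
  exists W, [/\ uniq W, size W = LHsum a b L0 H0 L1 H1 r &
    {in W, forall s, exists2 i, i <= r & rooted i s}].
Proof.
suff: exists W, [/\ uniq W,
    size W = \sum_(0 <= i < r.+1)
      (Lrec a b L0 H0 L1 H1 i + Hrec a b L0 H0 L1 H1 i) &
    {in W, forall s, exists2 i, i < r.+1 & rooted i s}] by [].
elim: r.+1 => [|m [W [uW sW rW]]]; first by exists [::]; rewrite big_geq.
have [SL [SH [lL lH]]] := layers m.
exists (W ++ (SL ++ SH)).
have rS s : s \in SL ++ SH -> rooted m s.
  case: lL lH => [_ _ rL] [_ _ rH].
  by rewrite mem_cat => /orP[/rL/andP[]|/rH/andP[]].
split.
- rewrite cat_uniq uW (layer_uniq_cat lL lH) andbT.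
  (* Weight and root determine the index, so distinct layers are disjoint. *)
  apply/hasPn => s /rS /and3P[_ /eqP ws _].
  by apply/negP => /rW[i im /and3P[_ /eqP ws' _]]; lia.
- rewrite big_nat_recr //= !size_cat sW.
  by case: lL lH => [_ -> _] [_ -> _].
move=> s; rewrite mem_cat => /orP[/rW[i im ri]|/rS rm]; last by exists m.
by exists i => //; apply: ltnW.
Qed.

Lemma LHsum_leq_card r :
  (forall i j s t, i <= r -> j <= r -> rooted i s -> rooted j t ->
    head x0 s = head x0 t -> s = t) ->
  LHsum a b L0 H0 L1 H1 r <= #|T|.
Proof.
move=> hinj; have [W [uW <- rW]] := rooted_ball r.
rewrite -(size_map (head x0)) -(card_uniqP _) ?max_card // map_inj_in_uniq //.
move=> s t /rW[i ir rs] /rW[j jr rt]; exact: hinj rs rt.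
Qed.

End Layers.

(** * Moore bounds from a vertex and from an edge *)

Lemma nbwalk_catr s t : nbwalk (s ++ t) -> nbwalk t.
Proof. by elim: s => [|x s IH] //= /andP[/IH]. Qed.

Section Roots.
Variables (a b g : nat).
Hypotheses (regL : regular (light G) a) (regH : regular (heavy G) b).
Hypothesis gmin : forall c, wcycle G c -> g <= weight G c.

Lemma nbwalk_inj x0 s t :
  0 < size s -> 0 < size t -> nbwalk s -> nbwalk t ->
  head x0 s = head x0 t -> last x0 s = last x0 t ->
  walk_weight s + walk_weight t < g -> s = t.
Proof.
case: s t => [|x s] [|y t] // _ _ ws wt /= xy; subst y => lst wg.
by rewrite (nbwalk_eq gmin ws wt lst wg).
Qed.

Lemma layer_nil i x0 c bases E : layer x0 c bases i E [::] 0.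
Proof. by []. Qed.

Lemma layer1_light x0 c bases E A n k :
  layer x0 c bases 0 E A n -> {in A, forall s, size (nexts (light G) s) = k} ->
  layer x0 c bases 1 light_end (extend (light G) A) (k * n).
Proof.
move=> [uA <- rA] Ak; split; [exact: uniq_extend | exact: size_extend |].
by move=> t /mem_extend[s [z [/rA/andP[rs _] -> zs]]]; apply: rooted_light.
Qed.

Lemma vertex_bound (x0 : T) r : 2 * r < g -> LHsum a b 1 0 a 0 r <= #|T|.
Proof.
(* No heavy edge fits in weight at most 1, hence the zero heavy base values. *)
move=> rg; pose c (_ : T) := 0; pose bases := [:: [:: x0]].
have lA : layer x0 c bases 0 light_end [:: [:: x0]] 1.
  by split=> // s; rewrite inE => /eqP ->; rewrite /rooted /= suffix_refl.
have lA1 : layer x0 c bases 1 light_end (extend (light G) [:: [:: x0]]) a.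
  rewrite -[a in layer _ _ _ _ _ _ a]muln1; apply: layer1_light lA _ => s.
  by rewrite inE => /eqP ->; rewrite (size_nexts _ _ regL) subn0.
apply: (LHsum_leq_card regL regH lA (layer_nil _ _ _ _ _) lA1
  (layer_nil _ _ _ _ _)).
have root s i : rooted x0 c bases i s ->
    [/\ nbwalk s, walk_weight s = i, 0 < size s & last x0 s = x0].
  case/and3P => ws /eqP wt; rewrite /= orbF => /suffixP[s' es].
  by split; rewrite // ?wt ?addn0 // es ?last_cat // size_cat addnS.
move=> i j s t ir jr /root[ws wi s0 ls] /root[wt wj t0 lt] hst.
by apply: (@nbwalk_inj x0); rewrite ?ls ?lt //; lia.
Qed.

Section EdgeRoot.
Variables (u v : T) (c : T -> nat) (r : nat).
Let w := edge_weight G u v.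
Let bases := [:: [:: u; v]; [:: v; u]].
Hypotheses (cu : c u <= w) (cv : c v <= w) (cuv : c u + c v <= w.+1).
Hypothesis rg : 2 * r + 1 < g.

(** For equal roots, [c y <= w] leaves total weight at most [2 * r] after the two deletions. For
    opposite roots, one deletion leaves [i + j + c u + c v - w], at most [2 * r + 1]. *)
Lemma edge_root_inj i j s t :
  i <= r -> j <= r -> rooted u c bases i s -> rooted u c bases j t ->
  head u s = head u t -> s = t.
Proof.
have root k p : rooted u c bases k p -> exists p' x y,
    [/\ p = p' ++ [:: x; y], nbwalk p, nbwalk (rcons p' x),
        walk_weight p = k + c y /\ walk_weight (rcons p' x) + w = k + c y &
        (x = u /\ y = v) \/ (x = v /\ y = u)].
  move=> /and3P[wp /eqP kp] /=; rewrite orbF => hp.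
  suff [p' [x [y [ep xy]]]] : exists p' x y,
      p = p' ++ [:: x; y] /\ ((x = u /\ y = v) \/ (x = v /\ y = u)).
    exists p', x, y; rewrite ep last_cat /= in wp kp *.
    have ep2 : p' ++ [:: x; y] = rcons (rcons p' x) y by rewrite -!cats1 -catA.
    split=> //.
      by apply: (@nbwalk_catl _ [:: y]); rewrite cats1 -ep2.
    split=> //; rewrite -kp ep2 walk_weight_rcons; congr (_ + _).
    by rewrite /w; case: xy => -[-> ->] //; rewrite edge_weight_sym.
  by case/orP: hp => /suffixP[p' ->]; exists p';
    [exists u, v | exists v, u]; split => //; [left | right].
move=> ir jr /root[s' [x [y [es ws ws' [ks ks'] xy]]]].
move=> /root[t' [x' [y' [et wt wt' [kt kt'] xy']]]] hst.
have hs' : head u (rcons s' x) = head u s by rewrite es; case: (s').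
have ht' : head u (rcons t' x') = head u t by rewrite et; case: (t').
have s0 : 0 < size (rcons s' x) by rewrite size_rcons.
have t0 : 0 < size (rcons t' x') by rewrite size_rcons.
(* Same root: the root edge is dropped from both walks.  Opposite roots: it is
   dropped from s only, the two walks then ending at the same vertex. *)
have [xx|xx] := eqVneq x x'.
  have yy : y = y' by case: xy xy' xx => -[-> ->] [] [-> ->].
  subst x' y'; suff : rcons s' x = rcons t' x.
    by move/rcons_inj => [e]; rewrite es et e.
  apply: (@nbwalk_inj u) => //; first by rewrite hs' ht'.
    by rewrite !last_rcons.
  have : c y <= w by case: xy => -[_ ->].
  lia.
have [xy1 xy2] : x = y' /\ y = x'.
  by case: xy xy' xx => -[-> ->] [] [-> ->] //; rewrite eqxx.
(* This equality would make [s] end in [y, x, y], a backtracking. *)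
subst y' x'; suff e : rcons s' x = t.
  move: ws; rewrite es -cat_rcons e et -catA.
  by move/nbwalk_catr; rewrite /= eqxx !andbF.
apply: (@nbwalk_inj u) => //.
- by rewrite et size_cat addnS.
- by rewrite hs'.
- by rewrite last_rcons et last_cat.
have : c x + c y <= w.+1 by case: xy => -[-> ->] //; rewrite addnC.
lia.
Qed.

End EdgeRoot.

Lemma light_edge_bound u v r :
  light G u v -> 2 * r + 1 < g -> LHsum a b 2 0 (2 * (a - 1)) 0 r <= #|T|.
Proof.
(* The discount cancels the root edge, so both orientations have index 0, and each has [a - 1] light
   continuations. *)
move=> luv rg; pose c (_ : T) := 1; pose bases := [:: [:: u; v]; [:: v; u]].
have uv : u != v by apply: contraTneq luv => ->; rewrite light_irr.
have lA : layer u c bases 0 light_end bases 2.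
  split=> //=; first by rewrite inE eqseq_cons (negPf uv).
  move=> s; rewrite !inE => /orP[] /eqP ->;
    by rewrite /rooted /light_end /= /edge_weight /edge 1?(light_sym G v) luv
      ?suffix_refl ?orbT.
have lA1 : layer u c bases 1 light_end (extend (light G) bases) (2 * (a - 1)).
  rewrite mulnC; apply: layer1_light lA _ => s.
  by rewrite !inE => /orP[] /eqP ->; rewrite (size_nexts _ _ regL) /=
    1?(light_sym G v) luv.
apply: (LHsum_leq_card regL regH lA (layer_nil _ _ _ _ _) lA1
  (layer_nil _ _ _ _ _)).
by move=> i j s t; apply: edge_root_inj => //; rewrite /edge_weight luv.
Qed.

Lemma heavy_edge_bound u v r :
  heavy G u v -> 2 * r + 1 < g -> LHsum a b 0 1 a 1 r <= #|T|.
Proof.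
(* Since [c u + c v] may not exceed 3, only one orientation gets the full discount: [[:: u; v]],
   rooted at [v], has index 0, while [[:: v; u]] has index 1. *)
move=> huv rg; pose c y := if y == v then 2 else 1.
pose bases := [:: [:: u; v]; [:: v; u]].
have uv : u != v by apply: contraTneq huv => ->; rewrite heavy_irr.
have luv : light G u v = false.
  by have := light_heavy_disj G u v; rewrite huv andbT => /negPf.
have lB : layer u c bases 0 heavy_end [:: [:: u; v]] 1.
  split=> // s; rewrite inE => /eqP ->.
  by rewrite /rooted /heavy_end /= /edge_weight /edge /c eqxx huv luv suffix_refl.
have lB1 : layer u c bases 1 heavy_end [:: [:: v; u]] 1.
  split=> // s; rewrite inE => /eqP ->.
  by rewrite /rooted /heavy_end /= /edge_weight /edge /c (negPf uv) heavy_sym huv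
    light_sym luv suffix_refl /= orbT.
have lA1 : layer u c bases 1 light_end (extend (light G) [:: [:: u; v]]) a.
  rewrite -[a in layer _ _ _ _ _ _ a]muln1; apply: layer1_light lB _ => s.
  by rewrite inE => /eqP ->; rewrite (size_nexts _ _ regL) /= luv subn0.
apply: (LHsum_leq_card regL regH (layer_nil _ _ _ _ _) lB lA1 lB1).
by move=> i j s t; apply: edge_root_inj => //;
  rewrite /edge_weight luv /c ?eqxx ?(negPf uv).
Qed.

End Roots.
End Walks.

(** * Parity correction and the three bounds *)

Lemma regular_edge (T : finType) (e : rel T) d (x : T) :
  0 < d -> regular e d -> exists y, e x y.
Proof.
move=> d0 /(_ x) ed; rewrite -ed in d0.
by case/card_gt0P: d0 => y; rewrite inE; exists y.
Qed.

(** If an odd value of [M] were the order itself, the handshake lemma would force [a] and [b] to be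
    even; otherwise the order is at least one more. *)
Lemma Mplus_leq_min_order (M : nat -> nat -> nat -> nat) a b g :
  (forall (T : finType) (G : wgraph T) (x : T),
    regular (light G) a -> regular (heavy G) b ->
    (forall c, wcycle G c -> g <= weight G c) -> M a b g <= #|T|) ->
  le_enat (Some (Mplus M a b g)) (min_order a b g).
Proof.
move=> HM; case E: (min_order a b g) => [n|] //=.
have [[T [G [[rL rH gG] <-]]] _] := (min_enat_Some _ _).1 E.
have [[c [c3 _] _] gmin] := (min_enat_Some _ _).1 gG.
have MT : M a b g <= #|T|.
  (* A wcycle attaining the girth supplies the root vertex. *)
  case: c c3 => [|x c] // _; apply: (HM T G x rL rH) => c' cc'.
  by apply: gmin; exists c'.
rewrite /Mplus; case: ifP => // /andP[oM oab]; rewrite addn1 ltn_neqAle MT andbT.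
apply: contraTneq oab => MTe; rewrite MTe in oM.
have := handshake (light_sym G) (light_irr G) rL.
have := handshake (heavy_sym G) (heavy_irr G) rH.
by rewrite !oddM oM !andbT negb_or => -> ->.
Qed.

Theorem theorem10 (a b g : nat) (ha : 1 <= a) (hb : 1 <= b) (hg : 3 <= g) :
  [/\ odd g -> le_enat (Some (Mplus M1 a b g)) (min_order a b g),
      ~~ odd g -> le_enat (Some (Mplus M2 a b g)) (min_order a b g),
      le_enat (Some (Mplus M3 1 2 10)) (min_order 1 2 10)
    & Mplus M3 1 2 10 = 16].
Proof.
split.
- move=> og; apply: Mplus_leq_min_order => T G x rL rH gmin.
  by apply: (vertex_bound rL rH gmin x); lia.
- move=> eg; apply: Mplus_leq_min_order => T G x rL rH gmin.
  have [y xy] := regular_edge x ha rL.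
  by apply: (light_edge_bound rL rH gmin xy); lia.
- apply: Mplus_leq_min_order => T G x rL rH gmin.
  have [y xy] := regular_edge x (isT : 0 < 2) rH.
  exact: (heavy_edge_bound rL rH gmin xy).
(* The layers contribute 1, 2, 2, 4 and 6, which sum to 15; as [a = 1] is odd, the correction gives
   16. *)
by rewrite /Mplus /M3 /LHsum; rewrite !big_nat_recr //= big_geq.
Qed.
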